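(* For each $n\ge 1$, the set of banded totally positive $n\times n$ real matrices forms a semigroup under matrix multiplication; that is, the product of two banded totally positive matrices is banded totally positive.
   Context: Rows and columns are labelled $1,\dots,n$. For integers $p,q\ge 0$, a matrix $T\in\mathbb{R}^{n\times n}$ belongs to $B_{p,q}$ (banded with $p$ subdiagonals and $q$ superdiagonals) if $T_{i,j}=0$ whenever $j>i+q$ or $i>j+p$. For increasing sequences $i_1<\dots<i_r$ and $j_1<\dots<j_r$ in $\{1,\dots,n\}$, the minor with these rows and columns is $\det(T_{i_k,j_l})_{k,l=1}^r$. For $T\in B_{p,q}$ the minor is called trivial with respect to $(p,q)$ if there is $k\in\{1,\dots,r\}$ such that $j_k>i_k+q$ or $i_k>j_k+p$; otherwise it is nontrivial. The set $B_{p,q}\mathrm{TP}$ consists of those $T\in B_{p,q}$ all of whose nontrivial minors (with respect to $(p,q)$) are positive. A matrix is banded totally positive if it belongs to $B_{p,q}\mathrm{TP}$ for some $p,q\ge 0$. *)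

(* Defs.v *)
From mathcomp Require Import all_boot all_order all_algebra.
From mathcomp Require Import reals.

Set Implicit Arguments.
Unset Strict Implicit.
Unset Printing Implicit Defensive.

Import Order.TTheory GRing.Theory Num.Theory.
Local Open Scope ring_scope.

(* Rows and columns are numbered from 0 ('I_n); all conditions below only      *)
(* compare indices up to a common shift, so they agree with 1-based numbering. *)

(* T belongs to B_{p,q}: p subdiagonals and q superdiagonals. *)
Definition banded (R : realType) (n p q : nat) (T : 'M[R]_n) : Prop :=
  forall i j : 'I_n, (i + q < j)%N \/ (j + p < i)%N -> T i j = 0.

Definition increasing_seq (r n : nat) (f : 'I_r -> 'I_n) : Prop :=
  forall k l : 'I_r, (k < l)%N -> (f k < f l)%N.

Definition minor (R : realType) (n r : nat) (T : 'M[R]_n)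
    (f g : 'I_r -> 'I_n) : R :=
  \det (mxsub f g T).

Definition trivial_minor (n r p q : nat) (f g : 'I_r -> 'I_n) : Prop :=
  exists k : 'I_r, (f k + q < g k)%N \/ (g k + p < f k)%N.

(* The empty minor (r = 0) equals 1, so including it imposes no condition. *)
Definition banded_TP_with (R : realType) (n p q : nat) (T : 'M[R]_n) : Prop :=
  banded p q T /\
  forall (r : nat) (f g : 'I_r -> 'I_n),
    increasing_seq f -> increasing_seq g ->
    ~ trivial_minor p q f g -> 0 < minor T f g.

Definition banded_totally_positive (R : realType) (n : nat) (T : 'M[R]_n) :
    Prop :=
  exists p q : nat, banded_TP_with p q T.

(* Main.v *)
(** The product of matrices in [B_{p1,q1}TP] and [B_{p2,q2}TP] lies in
    [B_{p1+p2,q1+q2}TP].  Trivial minors of a banded matrix vanish, so all the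
    minors of both factors are nonnegative, and by the Cauchy-Binet formula a
    minor of the product with rows [f] and columns [g] is a sum of nonnegative
    terms.  If it is nontrivial, the intermediate index sequence
    [h k = max (k, f k - p1, g k - q2)] gives a positive term. *)
Require Import Defs.
From mathcomp Require Import all_boot all_order all_algebra.
From mathcomp Require Import all_fingroup zify.
From mathcomp Require Import reals.

Local Open Scope ring_scope.

Set Implicit Arguments.
Unset Strict Implicit.
Unset Printing Implicit Defensive.

Import Order.TTheory GRing.Theory Num.Theory.

(** Multilinearity in the rows: expanding the product over [k] of the entries of [C *m D] amounts to
    choosing a summation index [h k] for each row. *)
Lemma det_mulmx_ffun (R : comNzRingType) (r n : nat)
    (C : 'M[R]_(r, n)) (D : 'M[R]_(n, r)) :
  \det (C *m D) =
  \sum_(h : {ffun 'I_r -> 'I_n}) (\prod_k C k (h k)) * \det (rowsub h D).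
Proof.
rewrite /determinant.
under [RHS]eq_bigr => h _ do rewrite mulr_sumr.
rewrite exchange_big /=; apply: eq_bigr => s _.
under eq_bigr => k _ do rewrite mxE.
rewrite bigA_distr_bigA mulr_sumr; apply: eq_bigr => h _.
rewrite big_split /= mulrCA; congr (_ * (_ * _)).
by apply: eq_bigr => k _; rewrite mxE.
Qed.

Lemma det_rowsub_perm (R : comNzRingType) (r n : nat) (D : 'M[R]_(n, r))
    (h : 'I_r -> 'I_n) (s : 'S_r) :
  \det (rowsub (h \o s) D) = (-1) ^+ s * \det (rowsub h D).
Proof.
rewrite -det_perm -det_mulmx -row_permE; congr (\det _).
by apply/matrixP => i j; rewrite !mxE.
Qed.

Lemma det_colsub_perm (R : comNzRingType) (r n : nat) (C : 'M[R]_(r, n))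
    (h : 'I_r -> 'I_n) (s : 'S_r) :
  \det (colsub (h \o s) C) = (-1) ^+ s * \det (colsub h C).
Proof.
by rewrite -[LHS]det_tr -[X in _ = _ * X]det_tr !trmx_mxsub det_rowsub_perm.
Qed.

(* Summing over all functions [h], rather than over the increasing ones,
   counts every term of the usual Cauchy-Binet formula [r`!] times. *)
Lemma Cauchy_Binet_ffun (R : comNzRingType) (r n : nat)
    (C : 'M[R]_(r, n)) (D : 'M[R]_(n, r)) :
  \det (C *m D) *+ r`! =
  \sum_(h : {ffun 'I_r -> 'I_n}) \det (colsub h C) * \det (rowsub h D).
Proof.
under eq_bigr => h _ do rewrite {1}/determinant mulr_suml.
rewrite exchange_big /= -(card_Sn r) -sumr_const.
apply: eq_big => [s|s _]; first by rewrite inE.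
rewrite det_mulmx_ffun.
have inj : injective (fun h : {ffun 'I_r -> 'I_n} => [ffun k => h (s k)]).
  move=> h1 h2 /ffunP E; apply/ffunP => k.
  by have := E (s^-1 k)%g; rewrite !ffunE permKV.
(* Each permutation [s] contributes one copy of [\det (C *m D)]: replacing [h] by [h \o s] in its
   expansion produces exactly the [s]-term of the Leibniz formula for [\det (colsub h C)]. *)
rewrite (reindex_inj inj); apply: eq_bigr => h _.
have -> : \det (rowsub [ffun k => h (s k)] D) = \det (rowsub (h \o s) D).
  by congr (\det _); apply/matrixP => i j; rewrite !mxE ffunE.
rewrite det_rowsub_perm mulrA [X in _ = X * _]mulrC; congr (_ * _ * _).
by apply: eq_bigr => k _; rewrite mxE ffunE.
Qed.

(** By pigeonhole, no permutation sends the [k + 1] indices up to [k] into the [k] indices below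
    [k], so every Leibniz term meets the zero block. *)
Lemma det_upper_right_zero (R : comNzRingType) (r : nat) (M : 'M[R]_r)
    (k : 'I_r) :
  (forall i j : 'I_r, (i <= k <= j)%N -> M i j = 0) -> \det M = 0.
Proof.
move=> M0; rewrite /determinant big1 // => s _.
have [i ik ksi] : exists2 i : 'I_r, (i <= k)%N & (k <= s i)%N.
  apply/exists_inP; apply: contraT => /exists_inPn H.
  have: (s @: [set i : 'I_r | i <= k] \subset [set i : 'I_r | i < k])%N.
    apply/subsetP => _ /imsetP[i ik ->]; rewrite inE ltnNge; apply: H.
    by rewrite inE in ik.
  move/subset_leq_card; rewrite card_imset; last exact: perm_inj.
  rewrite leqNgt => /negP[]; apply: proper_card; apply/properP; split.
    by apply/subsetP => i; rewrite !inE => /ltnW.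
  by exists k; rewrite !inE ?leqnn ?ltnn.
by rewrite (bigD1 i) //= M0 ?ik // mul0r mulr0.
Qed.

Lemma increasing_seq_leq (r n : nat) (f : 'I_r -> 'I_n) (i j : 'I_r) :
  increasing_seq f -> (i <= j)%N -> (f i <= f j)%N.
Proof. by move=> incf; rewrite leq_eqVlt => /predU1P[/val_inj->//|/incf/ltnW]. Qed.

Lemma increasing_seq_geq_id (r n : nat) (f : 'I_r -> 'I_n) :
  increasing_seq f -> forall k : 'I_r, (k <= f k)%N.
Proof.
move=> incf [k]; elim: k => [//|k IHk] kr.
have := IHk (ltnW kr); move/leq_ltn_trans; apply.
exact: incf.
Qed.

(** By monotonicity of [f] and [g], one entry [(k, k)] outside the band forces a whole corner block
    of zeros; the lower left case follows by transposition. *)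
Lemma trivial_minor_eq0 (R : realType) (n r p q : nat) (T : 'M[R]_n)
    (f g : 'I_r -> 'I_n) :
  banded p q T -> increasing_seq f -> increasing_seq g ->
  trivial_minor p q f g -> minor T f g = 0.
Proof.
move=> bT incf incg [k [fg|gf]].
  apply: (@det_upper_right_zero _ _ _ k) => i j /andP[ik kj].
  rewrite mxE; apply: bT; left.
  have := increasing_seq_leq incf ik; have := increasing_seq_leq incg kj; lia.
rewrite /minor -det_tr.
apply: (@det_upper_right_zero _ _ _ k) => i j /andP[ik kj].
rewrite !mxE; apply: bT; right.
have := increasing_seq_leq incg ik; have := increasing_seq_leq incf kj; lia.
Qed.

Lemma minor_ge0 (R : realType) (n r p q : nat) (T : 'M[R]_n)
    (f g : 'I_r -> 'I_n) :
  banded_TP_with p q T -> increasing_seq f -> increasing_seq g ->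
  0 <= minor T f g.
Proof.
move=> [bT posT] incf incg.
case: (boolp.pselect (trivial_minor p q f g)) => [tr|ntr].
  by rewrite (trivial_minor_eq0 bT).
exact/ltW/posT.
Qed.

Lemma injective_sort (r n : nat) (h : 'I_r -> 'I_n) :
  injective h -> exists s : 'S_r, increasing_seq (h \o s).
Proof.
move=> injh; pose t := [tuple h i | i < r].
pose le := fun x y : 'I_n => (x <= y)%N.
have /tuple_permP[s Es] : perm_eq (sort_tuple le t) t by rewrite perm_sort.
exists s => k l kl /=.
have nthE (i : 'I_r) : nth (h k) (sort le t) i = h (s i).
  rewrite [sort _ _]Es (nth_map i) ?size_enum_ord // nth_ord_enum.
  by rewrite tnth_mktuple.
have sle : sorted le (sort le t).
  by apply: sort_sorted => x y; apply: leq_total.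
have le_trans : transitive le by move=> y x z; apply: leq_trans.
have := sorted_leq_nth le_trans (fun x => leqnn x) (h k) sle.
move/(_ k l); rewrite !inE !size_sort !size_tuple !nthE => /(_ (ltn_ord k)).
move=> /(_ (ltn_ord l) (ltnW kl)); rewrite /le leq_eqVlt => /predU1P[|//].
by move=> /val_inj/injh/perm_inj E; rewrite E ltnn in kl.
Qed.

(** Sorting an injective [h] changes both minors by the same sign, which squares to 1. Otherwise the
    minor of [B] has two equal rows. *)
Lemma minor_mul_ge0 (R : realType) (n r p1 q1 p2 q2 : nat) (A B : 'M[R]_n)
    (f g h : 'I_r -> 'I_n) :
  banded_TP_with p1 q1 A -> banded_TP_with p2 q2 B ->
  increasing_seq f -> increasing_seq g ->
  0 <= minor A f h * minor B h g.
Proof.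
move=> tpA tpB incf incg.
case: (boolP (injectiveb h)) => [/injectiveP injh|/injectivePn[i [j ij hij]]].
  have [s incs] := injective_sort injh.
  have := mulr_ge0 (minor_ge0 tpA incf incs) (minor_ge0 tpB incs incg).
  rewrite /minor (_ : mxsub f (h \o s) A = colsub (h \o s) (rowsub f A)).
    rewrite (_ : mxsub (h \o s) g B = rowsub (h \o s) (colsub g B)).
      rewrite det_colsub_perm det_rowsub_perm mulrACA -expr2 sqrr_sign mul1r.
      by rewrite -!mxsub_comp.
    by rewrite -mxsub_comp.
  by rewrite -mxsub_comp.
rewrite /minor (_ : \det (mxsub h g B) = 0) ?mulr0 //.
by apply: (determinant_alternate ij) => k; rewrite !mxE hij.
Qed.

Lemma intermediate_sequence (n r p1 q1 p2 q2 : nat) (f g : 'I_r -> 'I_n) :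
  increasing_seq f -> increasing_seq g ->
  ~ trivial_minor (p1 + p2) (q1 + q2) f g ->
  exists h : 'I_r -> 'I_n, [/\ increasing_seq h,
    ~ trivial_minor p1 q1 f h & ~ trivial_minor p2 q2 h g].
Proof.
move=> incf incg ntr.
have ltn_h (k : 'I_r) : (maxn k (maxn (f k - p1) (g k - q2)) < n)%N.
  have := increasing_seq_geq_id incf k.
  have := ltn_ord (f k); have := ltn_ord (g k); lia.
have bounds (k : 'I_r) : [/\ (k <= f k)%N, (k <= g k)%N,
    (g k <= f k + (q1 + q2))%N & (f k <= g k + (p1 + p2))%N].
  split; rewrite ?increasing_seq_geq_id //.
    by rewrite leqNgt; apply/negP => H; apply: ntr; exists k; left.
  by rewrite leqNgt; apply/negP => H; apply: ntr; exists k; right.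
(* This is the least choice respecting the lower bounds [f k - p1] and [g k - q2]. Since subtraction
   truncates at 0, the term [k] is what keeps the sequence strictly increasing; [bounds] gives the
   upper bounds [f k + q1] and [g k + p2]. *)
exists (fun k => Ordinal (ltn_h k)); split.
- by move=> k l kl /=; have := incf k l kl; have := incg k l kl; lia.
- by case=> k /=; have [] := bounds k; lia.
- by case=> k /=; have [] := bounds k; lia.
Qed.

Lemma banded_mul (R : realType) (n p1 q1 p2 q2 : nat) (A B : 'M[R]_n) :
  banded p1 q1 A -> banded p2 q2 B -> banded (p1 + p2) (q1 + q2) (A *m B).
Proof.
move=> bA bB i j ij; rewrite mxE big1 // => l _.
have [/bA->|/bB->] : ((i + q1 < l)%N \/ (l + p1 < i)%N) \/
    ((l + q2 < j)%N \/ (j + p2 < l)%N) by lia.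
  by rewrite mul0r.
by rewrite mulr0.
Qed.

Lemma banded_TP_with_mul (R : realType) (n p1 q1 p2 q2 : nat)
    (A B : 'M[R]_n) :
  banded_TP_with p1 q1 A -> banded_TP_with p2 q2 B ->
  banded_TP_with (p1 + p2) (q1 + q2) (A *m B).
Proof.
move=> tpA tpB; split; first exact: banded_mul tpA.1 tpB.1.
move=> r f g incf incg ntr.
have [h [inch ntrA ntrB]] := intermediate_sequence incf incg ntr.
have r_gt0 := fact_gt0 r.
rewrite -(pmulrn_lgt0 _ r_gt0) /minor mxsub_mul Cauchy_Binet_ffun.
pose h' := [ffun k => h k].
under eq_bigr => e _ do rewrite -!mxsub_comp /=.
rewrite (bigD1 h') //= ltr_wpDr //.
  by apply: sumr_ge0 => e _; exact: (minor_mul_ge0 e tpA tpB incf incg).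
rewrite (@eq_mxsub _ _ _ _ _ f f h' h) ?(@eq_mxsub _ _ _ _ _ h' h g g) //.
- by apply: mulr_gt0; [apply: tpA.2|apply: tpB.2].
- by move=> k; rewrite ffunE.
- by move=> k; rewrite ffunE.
Qed.

Theorem theorem2p18 (R : realType) (n : nat) (hn : (1 <= n)%N)
    (A B : 'M[R]_n)
    (hA : banded_totally_positive A) (hB : banded_totally_positive B) :
  banded_totally_positive (A *m B).
Proof.
have [p1 [q1 tpA]] := hA; have [p2 [q2 tpB]] := hB.
by exists (p1 + p2)%N, (q1 + q2)%N; apply: banded_TP_with_mul.
Qed.
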